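(* Let $0<a<b$, and consider the continuous time linear regression model $$\mathbf{Y}(t)=\mathbf{F}^\top(t)\theta+\mathbf{\Sigma}^{1/2}\boldsymbol{\varepsilon}(t),\qquad t\in[a,b],$$ where $\theta\in\mathbb{R}^p$, $\mathbf{F}$ is a continuously differentiable $(p\times2)$-matrix valued function on $[a,b]$, $\boldsymbol{\varepsilon}=(\varepsilon_1,\varepsilon_2)^\top$ is a vector of two independent Brownian motions on $[a,b]$, and $\mathbf{\Sigma}=\begin{pmatrix}\sigma_1^2&\sigma_1\sigma_2\varrho\\ \sigma_1\sigma_2\varrho&\sigma_2^2\end{pmatrix}$ with $\sigma_1,\sigma_2>0$, $\varrho\in(-1,1)$. Let $$\mathbf{M}_0=\int_a^b\dot{\mathbf{F}}(s)\mathbf{\Sigma}^{-1}\dot{\mathbf{F}}^\top(s)\,ds,\qquad \mathbf{M}=\mathbf{M}_0+\frac1a\mathbf{F}(a)\mathbf{\Sigma}^{-1}\mathbf{F}^\top(a),$$ with $\mathbf{M}$ non-singular. Let $a=t_1<t_2<\dots<t_n=b$ and assume that the matrix $$\mathbf{B}=\sum_{i=2}^n\frac{[\mathbf{F}(t_i)-\mathbf{F}(t_{i-1})]\mathbf{\Sigma}^{-1}[\mathbf{F}(t_i)-\mathbf{F}(t_{i-1})]^\top}{t_i-t_{i-1}}$$ is non-singular. For $(p\times2)$-matrices $\mathbf{\Phi}_2,\dots,\mathbf{\Phi}_n$ consider the estimator $$\hat\theta_n=\mathbf{M}^{-1}\Big\{\sum_{i=2}^n\mathbf{\Phi}_i\mathbf{\Sigma}^{-1}(\mathbf{Y}(t_i)-\mathbf{Y}(t_{i-1}))+\frac{1}{a}\mathbf{F}(a)\mathbf{\Sigma}^{-1}\mathbf{Y}(a)\Big\}.\qquad(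 * )$$ Let $\mathbf{\Phi}_2^*,\dots,\mathbf{\Phi}_n^*$ be the $(p\times2)$-matrices $$\mathbf{\Phi}_i^*=\mathbf{M}_0\mathbf{B}^{-1}\,\frac{\mathbf{F}(t_i)-\mathbf{F}(t_{i-1})}{t_i-t_{i-1}},\qquad i=2,\dots,n.$$ Then $\mathbf{\Phi}_2^*,\dots,\mathbf{\Phi}_n^*$ are optimal weight matrices minimizing $$\mathbb{E}_\theta[(\hat\theta_{\rm BLUE}-\hat\theta_n)(\hat\theta_{\rm BLUE}-\hat\theta_n)^\top]$$ with respect to the Loewner ordering among all unbiased estimators of the form $( * )$. Moreover, the variance of the resulting estimator $\hat\theta_n^*$ (that is, $( * )$ with $\mathbf{\Phi}_i=\mathbf{\Phi}_i^*$) is given by $$\mathrm{Cov}(\hat\theta_n^* )=\mathbf{M}^{-1}\Big\{\mathbf{M}_0\mathbf{B}^{-1}\mathbf{M}_0+\frac1a\mathbf{F}(a)\mathbf{\Sigma}^{-1}\mathbf{F}^\top(a)\Big\}\mathbf{M}^{-1}.$$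
   Context: The Brownian motions on $[a,b]$ are centered continuous Gaussian processes with covariance $\min(s,t)$; $\mathbf{\Sigma}^{1/2}$ is the symmetric square root of $\mathbf{\Sigma}$; a dot denotes differentiation. The columns of $\mathbf{F}^\top$ (two-dimensional functions) are assumed to be linearly independent. $\hat\theta_{\rm BLUE}$ is the best linear unbiased estimator in the continuous time model, $$\hat\theta_{\rm BLUE}=\mathbf{M}^{-1}\Big(\int_a^b\dot{\mathbf{F}}(t)\mathbf{\Sigma}^{-1}\,d\mathbf{Y}(t)+\frac1a\mathbf{F}(a)\mathbf{\Sigma}^{-1}\mathbf{Y}(a)\Big).$$ An estimator is unbiased if its expectation equals $\theta$ for every $\theta\in\mathbb{R}^p$. Loewner ordering: $A\le B$ iff $B-A$ is nonnegative definite. $\mathbb{E}_\theta$ is expectation when $\theta$ is the true parameter. *)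

(* Defs.v *)
From HB Require Import structures.
From mathcomp Require Import all_boot all_order all_algebra.
From mathcomp Require Import all_classical all_reals all_analysis.
Set Implicit Arguments.
Unset Strict Implicit.
Unset Printing Implicit Defensive.
Import Order.TTheory GRing.Theory Num.Theory.
Import numFieldNormedType.Exports.
Local Open Scope classical_set_scope.
Local Open Scope ring_scope.

Definition nnd (R : realType) (m : nat) (A : 'M[R]_m) : Prop :=
  A^T = A /\ forall x : 'cV[R]_m, 0 <= (x^T *m A *m x) 0 0.

Definition loewner_le (R : realType) (m : nat) (A B : 'M[R]_m) : Prop :=
  nnd (B - A).

(* "The" symmetric square root: nonnegative definiteness makes it unique. *)
Definition is_sym_sqrt (R : realType) (m : nat) (S A : 'M[R]_m) : Prop :=
  nnd S /\ S *m S = A.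

Definition Sigma_mx (R : realType) (sigma1 sigma2 rho : R) : 'M[R]_2 :=
  \matrix_(i, j)
    if i == j then (if i == 0 then sigma1 ^+ 2 else sigma2 ^+ 2)
    else sigma1 * sigma2 * rho.

(* [F] is C^1 on [a, b] with derivative [dF]; difference quotients stay inside
   [a, b], so the derivative is one-sided at a and at b. *)
Definition C1_on (R : realType) (m q : nat) (a b : R)
    (F dF : R -> 'M[R]_(m, q)) : Prop :=
  forall i j,
    (forall t, t \in `[a, b] ->
       (F s i j - F t i j) / (s - t) @[s --> within `[a, b] t^'] --> dF t i j)
    /\ {within `[a, b], continuous (fun t => dF t i j)}.

Definition lin_indep_on (R : realType) (m q : nat) (a b : R)
    (F : R -> 'M[R]_(m, q)) : Prop :=
  forall c : 'cV[R]_m,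
    (forall t, t \in `[a, b] -> (F t)^T *m c = 0) -> c = 0.

Definition int_mx (R : realType) (m q : nat) (a b : R)
    (G : R -> 'M[R]_(m, q)) : 'M[R]_(m, q) :=
  \matrix_(i, j) \int[lebesgue_measure]_(s in `[a, b]) G s i j.

(* a = t_1 < ... < t_n = b; the values of [t] off 1, ..., n are irrelevant. *)
Definition is_subdivision (R : realType) (a b : R) (n : nat) (t : nat -> R) :
    Prop :=
  [/\ (2 <= n)%N, t 1%N = a, t n = b &
      forall i, (2 <= i <= n)%N -> t i.-1 < t i].

Section Probability.
Context (R : realType) (d : measure_display) (T : measurableType d).
Variable P : probability T R.

Definition is_gaussian (X : T -> R) : Prop :=
  measurable_fun [set: T] X /\
  ((exists m s : R, s != 0 /\
      forall A : set R, measurable A -> P (X @^-1` A) = normal_prob m s A) \/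
   (exists m : R,
      forall A : set R, measurable A -> P (X @^-1` A) = \d_m A)).

Definition gaussian_process (a b : R) (W : R -> T -> R) : Prop :=
  forall (k : nat) (s c : 'I_k -> R), (forall i, s i \in `[a, b]) ->
    is_gaussian (fun w => \sum_(i < k) c i * W (s i) w).

Definition brownian_on (a b : R) (W : R -> T -> R) : Prop :=
  [/\ gaussian_process a b W,
      {ae P, forall w, {within `[a, b], continuous (fun t => W t w)}},
      forall t, t \in `[a, b] -> ('E_P[W t] = 0)%E &
      forall s t, s \in `[a, b] -> t \in `[a, b] ->
        covariance P (W s) (W t) = (Num.min s t)%:E].

Definition process_sigma (a b : R) (W : R -> T -> R) : set (set T) :=
  <<s \bigcup_(t in `[a, b])
        preimage_set_system [set: T] (W t) (measurable : set (set R)) >>.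

Definition indep_processes (a b : R) (V W : R -> T -> R) : Prop :=
  forall A B : set T, process_sigma a b V A -> process_sigma a b W B ->
    P (A `&` B) = (P A * P B)%E.

Definition brownian2_on (a b : R) (eps : R -> T -> 'cV[R]_2) : Prop :=
  [/\ brownian_on a b (fun t w => eps t w 0 0),
      brownian_on a b (fun t w => eps t w 1 0) &
      indep_processes a b (fun t w => eps t w 0 0) (fun t w => eps t w 1 0)].

(* [J] is (a version of) the stochastic integral of the deterministic
   continuous integrand [G] against [Y] over [a, b]: the L^2 limit of the
   Riemann-Stieltjes sums as the mesh of the subdivision tends to 0. *)
Definition is_stoch_int (m q : nat) (a b : R) (G : R -> 'M[R]_(m, q))
    (Y : R -> T -> 'cV[R]_q) (J : T -> 'cV[R]_m) : Prop :=
  (forall k, measurable_fun [set: T] (fun w => J w k 0)) /\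
  forall e : R, 0 < e -> exists2 dlt : R, 0 < dlt &
    forall (n : nat) (s : nat -> R), is_subdivision a b n s ->
      (forall i, (2 <= i <= n)%N -> s i - s i.-1 < dlt) ->
      forall k,
        ('E_P[fun w => (((J w - \sum_(2 <= i < n.+1)
                 G (s i.-1) *m (Y (s i) w - Y (s i.-1) w)) k 0) ^+ 2)%R]
          < e%:E)%E.

(* Entrywise expectation; an entry is meaningful when it is integrable, which
   holds for products of square-integrable variables. *)
Definition exp_mx (m q : nat) (Z : T -> 'M[R]_(m, q)) : 'M[R]_(m, q) :=
  \matrix_(i, j) fine ('E_P[fun w => Z w i j])%E.

(* Stated in the extended reals, so that finiteness is part of the claim. *)
Definition has_mean (m : nat) (X : T -> 'cV[R]_m) (mu : 'cV[R]_m) : Prop :=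
  forall i, ('E_P[fun w => X w i 0%R] = (mu i 0)%:E)%E.

Definition has_cov (m : nat) (X : T -> 'cV[R]_m) (C : 'M[R]_m) : Prop :=
  forall i j,
    covariance P (fun w => X w i 0) (fun w => X w j 0) = (C i j)%:E.

End Probability.

Section Model.
Context (R : realType) (p : nat).
Variables (a b : R) (F dF : R -> 'M[R]_(p, 2)) (Sigma : 'M[R]_2).

Definition M0_mx : 'M[R]_p :=
  int_mx a b (fun s => dF s *m invmx Sigma *m (dF s)^T).

Definition M_mx : 'M[R]_p :=
  M0_mx + a^-1 *: (F a *m invmx Sigma *m (F a)^T).

Definition B_mx (n : nat) (t : nat -> R) : 'M[R]_p :=
  \sum_(2 <= i < n.+1) (t i - t i.-1)^-1 *:
    ((F (t i) - F (t i.-1)) *m invmx Sigma *m (F (t i) - F (t i.-1))^T).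

Definition Phi_star (n : nat) (t : nat -> R) (i : nat) : 'M[R]_(p, 2) :=
  M0_mx *m invmx (B_mx n t) *m
    ((t i - t i.-1)^-1 *: (F (t i) - F (t i.-1))).

(* [y] is the observed trajectory. *)
Definition theta_n (n : nat) (t : nat -> R) (Phi : nat -> 'M[R]_(p, 2))
    (y : R -> 'cV[R]_2) : 'cV[R]_p :=
  invmx M_mx *m
    (\sum_(2 <= i < n.+1) Phi i *m invmx Sigma *m (y (t i) - y (t i.-1))
     + a^-1 *: (F a *m invmx Sigma *m y a)).

(* [J] is the value of the stochastic integral of [dF *m invmx Sigma] along
   the trajectory [y]. *)
Definition theta_BLUE (J : 'cV[R]_p) (y : R -> 'cV[R]_2) : 'cV[R]_p :=
  invmx M_mx *m (J + a^-1 *: (F a *m invmx Sigma *m y a)).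

End Model.

(* The observed process when [theta] is the true parameter, [S] being the
   square root of Sigma: an expectation under [theta] of a functional of the
   data is the expectation of that functional of [obs F S eps theta]. *)
Definition obs (R : realType) (T : Type) (p : nat) (F : R -> 'M[R]_(p, 2))
    (S : 'M[R]_2) (eps : R -> T -> 'cV[R]_2) (theta : 'cV[R]_p)
    (t : R) (w : T) : 'cV[R]_2 :=
  (F t)^T *m theta + S *m eps t w.

Definition unbiased (R : realType) (d : measure_display)
    (T : measurableType d) (P : probability T R) (p : nat)
    (Y : 'cV[R]_p -> R -> T -> 'cV[R]_2)
    (est : (R -> 'cV[R]_2) -> 'cV[R]_p) : Prop :=
  forall theta, has_mean P (fun w => est (fun t => Y theta t w)) theta.

(* Main.v *)
Require Import Defs.
From HB Require Import structures.
From mathcomp Require Import all_boot all_order all_algebra.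
From mathcomp Require Import all_classical all_reals all_analysis.
From mathcomp Require Import measurable_realfun.
From mathcomp Require Import ring lra zify.
Set Implicit Arguments.
Unset Strict Implicit.
Unset Printing Implicit Defensive.
Import Order.TTheory GRing.Theory Num.Theory.
Import numFieldNormedType.Exports.
Local Open Scope classical_set_scope.
Local Open Scope ring_scope.

(** Let Z(t) = S eps(t) be the correlated noise, so that Y = F^T theta + Z.
    Independence of the two Brownian motions gives
    E[Z(u) Z(v)^T] = min(u, v) Sigma (lemma [noise_moment]), hence increments of
    Z over disjoint intervals are uncorrelated.  For weights Phi put

      N[Phi] = sum_i Phi_i Sigma^-1 (Z(t_i) - Z(t_{i-1})),
      C[Phi] = sum_i Phi_i Sigma^-1 (F(t_i) - F(t_{i-1}))^T,

    the random and the deterministic part of the weighted increments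
    ([weighted_noise] and [weighted_drift]).  The estimator with weights Phi has
    mean M^-1 (C[Phi] + F(a) Sigma^-1 F(a)^T / a) theta, so it is unbiased
    exactly when C[Phi] = M0, and the weights Phi* satisfy this equation.

    Two unbiased estimators of the family with weights Phi* and Phi therefore
    differ by M^-1 N[Q], where Q = Phi* - Phi and C[Q] = 0: the parameter has
    disappeared.  Optimality of Phi* is then Pythagoras' theorem in L^2, once
    the error of the estimator with weights Phi* is known to be orthogonal to
    N[Q].  That error is M^-1 (J - M0 theta - N[Phi*]), J being the stochastic
    integral, and

      E[J N[Q]^T] = C[Q]^T,     E[N[Phi*] N[Q]^T] = M0 B^-1 C[Q]^T,

    which both vanish.  The second identity comes from [weighted_noise_moment]
    because Phi*_i is proportional to the slope of F over the i-th interval.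
    The first follows from E[J Z(v)^T] = F(v) - F(a)
    ([stoch_int_noise_moment]).  To see the latter, compute it for a Riemann sum
    in place of J: the result is a Riemann sum of the derivative of F over
    [a, v], which converges to F(v) - F(a) by the mean value theorem and uniform
    continuity ([riemann_sum_stopped]); the Cauchy-Schwarz inequality passes to
    the L^2 limit J.

    The covariance formula is the same computation: it is the second moment of
    M^-1 (N[Phi*] + F(a) Sigma^-1 Z(a) / a), whose two summands are
    uncorrelated, and E[N[Phi*] N[Phi*]^T] = M0 B^-1 C[Phi*]^T = M0 B^-1 M0. *)

(** * Stopped Riemann sums of a continuously differentiable function *)

(** Heine-Cantor on a segment, from the filter form of compactness: a
    continuity radius at x serves, after halving, for all points near x. *)
Lemma segment_unif_continuous (R : realType) (a b : R) (f : R -> R) (e : R) :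
  {within `[a, b], continuous f} -> 0 < e ->
  exists2 dlt : R, 0 < dlt & forall x y, x \in `[a, b] -> y \in `[a, b] ->
    `|x - y| < dlt -> `|f x - f y| < e.
Proof.
move=> cf e0.
have e20 : 0 < e / 2 by lra.
have /compact_near_coveringP cov := @segment_compact R a b.
pose Q (i x : R) := x \in `[a, b] -> forall y, y \in `[a, b] -> `|x - y| < i ->
  `|f x - f y| < e.
have locQ x : `[a, b]%classic x ->
    \forall x' \near x & i \near (0:R)^'+, Q i x'.
  move=> xab.
  have /subspace_continuousP/(_ x xab) := cf.
  move=> /cvgrPdist_lt /(_ _ e20); rewrite near_withinE.
  case/nbhs_ballP => eta /= eta0 H.
  exists (ball x (eta / 2), [set i | 0 < i < eta / 2]) => /=.
    split; first by apply: nbhsx_ballx; lra.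
    near=> i => /=; apply/andP; split; near: i; [exact: nbhs_right_gt|].
    by apply: nbhs_right_lt; lra.
  move=> [x' i] /= [bx' /andP[i0 ieta]] x'ab y yab xyi.
  have h1 : `|f x - f x'| < e / 2.
    apply: H => /=; last exact: x'ab.
    by apply: (@le_ball _ _ _ (eta / 2)) => //; lra.
  have h2 : `|f x - f y| < e / 2.
    apply: H => /=; last exact: yab.
    move: bx'; rewrite /ball /= => bx'.
    have -> : x - y = (x - x') + (x' - y) by ring.
    by apply: le_lt_trans (ler_normD _ _) _; lra.
  have -> : f x' - f y = - (f x - f x') + (f x - f y) by ring.
  by apply: le_lt_trans (ler_normD _ _) _; rewrite normrN; lra.
have : \forall i \near (0:R)^'+, `[a, b]%classic `<=` Q i.
  exact: cov R _ Q (at_right_proper_filter 0) locQ.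
rewrite near_withinE => /nbhs_ballP[dlt /= dlt0 H].
exists (dlt / 2); first by lra.
move=> x y xab yab xy.
have hd : 0 < dlt / 2 by lra.
apply: (H (dlt / 2)) => //=.
by rewrite /ball /= sub0r normrN gtr0_norm //; lra.
Unshelve. all: by end_near. Qed.


(** Near t the increment of f is at most (|df t| + 1) |s - t|. *)
Lemma one_sided_derivable_continuous (R : realType) (a b : R) (f df : R -> R) :
  (forall t, t \in `[a, b] ->
     (f s - f t) / (s - t) @[s --> within `[a, b] t^'] --> df t) ->
  {within `[a, b], continuous f}.
Proof.
move=> df_lim; apply/subspace_continuousP => x xab.
apply/cvgrPdist_lt => e e0; rewrite near_withinE.
have /cvgrPdist_lt /(_ 1 ltr01) := df_lim x xab.
rewrite !near_withinE => /nbhs_ballP [eta /= eta0 H].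
have K0 : 0 < `|df x| + 1 by rewrite ltr_wpDl.
apply/nbhs_ballP; exists (Num.min eta (e / (`|df x| + 1))) => /=.
  by rewrite lt_min eta0 divr_gt0.
move=> s; rewrite /ball /= lt_min => /andP[xs_eta xs_e] sab.
have [->|sx] := eqVneq s x; first by rewrite subrr normr0.
have := H s xs_eta sx sab => Hq.
have sx0 : s - x != 0 by rewrite subr_eq0.
have : `|(f s - f x) / (s - x)| < `|df x| + 1.
  have -> : (f s - f x) / (s - x) = df x - (df x - (f s - f x) / (s - x)).
    by ring.
  by apply: le_lt_trans (ler_normB _ _) _; rewrite ltrD2l.
rewrite normrM normfV ltr_pdivrMr ?normr_gt0 // distrC => /lt_trans; apply.
by rewrite mulrC -ltr_pdivlMr // distrC.
Qed.

(** At an interior point the constraint that s lies in [a, b] is void for s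
    close to x, and the relative limit is an ordinary derivative. *)
Lemma one_sided_derivable_interior (R : realType) (a b x l : R) (f : R -> R) :
  a < x -> x < b ->
  (f s - f x) / (s - x) @[s --> within `[a, b] x^'] --> l ->
  is_derive x 1 f l.
Proof.
move=> ax xb lim_l.
have H : h^-1 *: ((f \o shift x) (h *: (1:R)) - f x) @[h --> 0^'] --> l.
  apply/cvgrPdist_lt => e e0.
  have /cvgrPdist_lt /(_ e e0) := lim_l.
  rewrite !near_withinE => /nbhs_ballP [eta /= eta0 H].
  apply/nbhs_ballP; exists (Num.min eta (Num.min (x - a) (b - x))) => /=.
    by rewrite !lt_min eta0; apply/andP; split => //; apply/andP; split; lra.
  move=> h; rewrite /ball /= sub0r normrN !lt_min => /and3P[h_eta h1 h2] h0.
  have xhab : x + h \in `[a, b].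
    by rewrite in_itv /=; move: h1 h2; rewrite !ltr_norml; lra.
  have := H (x + h); rewrite /ball /= opprD addNKr normrN => /(_ h_eta).
  have -> : x + h != x by rewrite -subr_eq0 addrAC subrr add0r.
  move=> /(_ isT xhab).
  by rewrite addrAC subrr add0r /= /GRing.scale /= mulr1 (addrC h) (mulrC h^-1).
split; first by apply/cvg_ex; exists l.
exact: cvg_lim H.
Qed.

Lemma one_sided_mvt (R : realType) (a b : R) (f df : R -> R) :
  (forall t, t \in `[a, b] ->
     (f s - f t) / (s - t) @[s --> within `[a, b] t^'] --> df t) ->
  forall u v, a <= u -> u <= v -> v <= b ->
  exists2 c, c \in `[u, v] & f v - f u = df c * (v - u).
Proof.
move=> df_lim u v au uv vb; apply: MVT_segment => //.
  move=> x; rewrite in_itv /= => /andP[ux xv].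
  have ax : a < x by exact: le_lt_trans ux.
  have xb : x < b by exact: lt_le_trans vb.
  apply: (one_sided_derivable_interior ax xb); apply: df_lim.
  by rewrite in_itv /= !ltW.
have /continuous_subspaceW := one_sided_derivable_continuous df_lim; apply.
by move=> y /=; rewrite !in_itv /= => /andP[uy yv]; apply/andP; split; lra.
Qed.

Lemma subdivision_le (R : realType) (a b : R) n (s : nat -> R) j k :
  is_subdivision a b n s -> (1 <= j)%N -> (j <= k <= n)%N -> s j <= s k.
Proof.
move=> [_ _ _ inc] j1; elim: k => [|k IH]; first by lia.
move=> /andP[]; rewrite leq_eqVlt => /predU1P[-> //|jk kn].
apply: le_trans (IH _) _; first by lia.
by apply: ltW; apply: (inc k.+1); lia.
Qed.

Lemma subdivision_sub (R : realType) (a b : R) n (s : nat -> R) i :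
  is_subdivision a b n s -> (1 <= i <= n)%N -> s i \in `[a, b].
Proof.
move=> sub iN; have [n2 s1 sn _] := sub.
by rewrite in_itv /= -s1 -sn !(subdivision_le sub) //; lia.
Qed.

(** This is a Riemann sum of df over [a, v], with the interval that contains v
    cut at v.  Writing f v - f a as the telescoping sum of the increments of
    f (min u v), each term differs from its Riemann counterpart by at most the
    oscillation of df on that interval times the increment of min u v.  Thanks
    to the cut, v need not be a point of the subdivision. *)
Lemma riemann_sum_stopped (R : realType) (a b v e : R) (f df : R -> R) :
  (forall t, t \in `[a, b] ->
     (f s - f t) / (s - t) @[s --> within `[a, b] t^'] --> df t) ->
  {within `[a, b], continuous df} ->
  v \in `[a, b] -> 0 < e ->
  exists2 dlt : R, 0 < dlt & forall n s, is_subdivision a b n s ->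
    (forall i, (2 <= i <= n)%N -> s i - s i.-1 < dlt) ->
    `|\sum_(2 <= i < n.+1) df (s i.-1) *
        (Num.min (s i) v - Num.min (s i.-1) v) - (f v - f a)| <= e.
Proof.
move=> df_lim df_cont; rewrite in_itv /= => /andP[av vb] e0.
have K0 : 0 < v - a + 1 by lra.
have e'0 : 0 < e / (v - a + 1) by rewrite divr_gt0.
(* The increments of min u v add up to v - a; the summand 1 keeps the
   denominator positive when v = a. *)
have [dlt dlt0 osc] := segment_unif_continuous df_cont e'0.
exists dlt => // n s sub mesh; have [n2 s1 sn inc] := sub.
set c := fun u => Num.min u v.
have s_ab i : (1 <= i <= n)%N -> a <= s i <= b.
  by move=> iN; have := subdivision_sub sub iN; rewrite in_itv.
have tele (g : R -> R) :
    \sum_(2 <= i < n.+1) (g (s i) - g (s i.-1)) = g (s n) - g (s 1%N).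
  rewrite big_add1 /= -[n]prednK; last by lia.
  rewrite -(telescope_sumr (fun i => g (s i))) /=; last by lia.
  by rewrite prednK //; lia.
have -> : f v - f a = \sum_(2 <= i < n.+1) (f (c (s i)) - f (c (s i.-1))).
  by rewrite (tele (f \o c)) /= sn s1 /c (min_r vb) (min_l av).
rewrite -sumrB.
apply: le_trans (ler_norm_sum _ _ _) _.
have step i : (2 <= i < n.+1)%N ->
    `|df (s i.-1) * (c (s i) - c (s i.-1)) - (f (c (s i)) - f (c (s i.-1)))|
    <= e / (v - a + 1) * (c (s i) - c (s i.-1)).
  move=> iN; have ltsi := inc i ltac:(lia).
  have [s'a s'b] : a <= s i.-1 /\ s i.-1 <= b by apply/andP/s_ab; lia.
  have [sa sb] : a <= s i /\ s i <= b by apply/andP/s_ab; lia.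
  have cc : c (s i.-1) <= c (s i) by rewrite /c le_min !ge_min lexx orbT ltW.
  have [xi xic ->] : exists2 x, x \in `[c (s i.-1), c (s i)] &
      f (c (s i)) - f (c (s i.-1)) = df x * (c (s i) - c (s i.-1)).
    apply: (one_sided_mvt df_lim) => //; rewrite /c ?le_min ?ge_min ?vb ?orbT//.
    by rewrite s'a av.
  rewrite -mulrBl normrM (ger0_norm (x := c (s i) - _)) ?subr_ge0 //.
  (* A nonzero increment forces s_{i-1} < v, so xi stays in [s_{i-1}, s_i]. *)
  move: cc; rewrite le_eqVlt => /predU1P[->|cc]; first by rewrite subrr !mulr0.
  apply: ler_wpM2r; first by rewrite subr_ge0 ltW.
  have s'v : s i.-1 <= v.
    rewrite leNgt; apply/negP => /ltW h; move: cc; rewrite /c (min_r h).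
    by rewrite lt_min ltxx andbF.
  move: xic; rewrite in_itv /= {1}/c (min_l s'v) => /andP[x1 x2].
  have x3 : xi <= s i by apply: le_trans x2 _; rewrite /c ge_min lexx.
  have hm : s i - s i.-1 < dlt by apply: mesh.
  apply: ltW; apply: osc; rewrite ?in_itv /= ?s'a ?s'b //.
    by rewrite (le_trans s'a x1) (le_trans x3 sb).
  rewrite distrC ger0_norm ?subr_ge0 //.
  by apply: le_lt_trans hm; rewrite lerD2r.
rewrite big_nat; apply: le_trans; first by apply: ler_sum => i; exact: step.
rewrite -big_nat -mulr_sumr (tele c) sn s1 /c (min_r vb) (min_l av).
by rewrite mulrAC ler_pdivrMr // ler_wpM2l ?ltW //; lra.
Qed.

Lemma fine_subdivision (R : realType) (a b dlt : R) : a < b -> 0 < dlt ->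
  exists n s, is_subdivision a b n s /\
    forall i, (2 <= i <= n)%N -> s i - s i.-1 < dlt.
Proof.
move=> ab dlt0.
have [m hm] : exists m : nat, (b - a) / dlt < m.+1%:R.
  exists (Num.truncn ((b - a) / dlt)); exact: truncnS_gt.
have m0 : 0 < m.+1%:R :> R by rewrite ltr0n.
set h := (b - a) / m.+1%:R.
have mh : m.+1%:R * h = b - a by rewrite /h mulrC divfK ?gt_eqF.
have h0 : 0 < h by rewrite divr_gt0 // subr_gt0.
have h_dlt : h < dlt by rewrite /h ltr_pdivrMr // mulrC -ltr_pdivrMr.
have step (i : nat) : (2 <= i)%N -> a + i.-1%:R * h - (a + i.-1.-1%:R * h) = h.
  by case: i => [|[|i]] // _; rewrite opprD addrACA subrr add0r /=
    -natr1 mulrDl mul1r addrAC subrr add0r.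
exists m.+2, (fun i => a + i.-1%:R * h); split.
  split=> //; first by rewrite mul0r addr0.
    by rewrite [_.-1]/= mh addrC subrK.
  by move=> i /andP[i2 _]; rewrite -subr_gt0 step.
by move=> i /andP[i2 _]; rewrite step.
Qed.

(** * The expectation of a product of independent variables *)

Lemma Lfun2_measurable d (T : measurableType d) (R : realType)
    (P : probability T R) (X : T -> R) :
  X \in Lfun P 2 -> measurable_fun [set: T] X.
Proof. by rewrite inE => /andP[/[!inE]]. Qed.

(** Independence says that the law of (X, Y) agrees with the product of the two
    laws on rectangles, hence everywhere; Fubini's theorem then factors the
    integral of the product. *)
Lemma expectation_indepM d (T : measurableType d) (R : realType)
    (P : probability T R) (X Y : T -> R) :
  X \in Lfun P 2 -> Y \in Lfun P 2 ->
  (forall A B : set R, measurable A -> measurable B ->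
     P ((X @^-1` A) `&` (Y @^-1` B)) = (P (X @^-1` A) * P (Y @^-1` B))%E) ->
  ('E_P[X \* Y] = 'E_P[X] * 'E_P[Y])%E.
Proof.
move=> X2 Y2 XYindep.
have mX := Lfun2_measurable X2; have mY := Lfun2_measurable Y2.
have Pfin : P setT \is a fin_num := fin_num_measure P _ measurableT.
have X1 := Lfun_subset12 Pfin X2; have Y1 := Lfun_subset12 Pfin Y2.
have XY1 := Lfun2_mul_Lfun1 X2 Y2.
have mX' : X \in mfun by rewrite inE.
have mY' : Y \in mfun by rewrite inE.
pose XY w := (X w, Y w).
have mXY : XY \in mfun by rewrite inE /=; exact: measurable_fun_pair.
pose PX := distribution P (mfun_Sub mX').
pose PY := distribution P (mfun_Sub mY').
pose PXY := distribution P (mfun_Sub mXY).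
have prodE C : measurable C -> (PX \x PY)%E C = PXY C.
  apply: product_measure_unique => A B mA mB.
  by rewrite /PXY /PX /PY /distribution /pushforward -XYindep.
pose f (z : R * R) : \bar R := (z.1 * z.2)%:E.
have mf : measurable_fun setT f.
  by apply/measurable_EFinP; exact: measurable_funM.
have intf : (PX \x PY)%E.-integrable setT f.
  apply/integrableP; split => //.
  rewrite (eq_measure_integral PXY); last by move=> C mC _; exact: prodE.
  rewrite ge0_integral_distribution => [|//|//]; last exact: measurableT_comp.
  by have /Lfun1_integrable/integrableP[] := XY1.
have -> : 'E_P[X \* Y]%E = (\int[(PX \x PY)%E]_z f z)%E.
  rewrite (eq_measure_integral PXY); last by move=> C mC _; exact: prodE.
  rewrite integral_distribution => [|//|]; first by rewrite unlock.
  by have /Lfun1_integrable := XY1.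
rewrite -integral12_prod_meas1 //.
have EY : 'E_P[Y]%E = (\int[PY]_y y%:E)%E.
  rewrite integral_distribution; first by rewrite unlock.
    by apply/measurable_EFinP.
  by have /Lfun1_integrable := Y1.
have EX : 'E_P[X]%E = (\int[PX]_x x%:E)%E.
  rewrite integral_distribution; first by rewrite unlock.
    by apply/measurable_EFinP.
  by have /Lfun1_integrable := X1.
have intX : PX.-integrable setT (fun x : R => x%:E).
  apply: integrable_pushforward => //; first by apply/measurable_EFinP.
  by have /Lfun1_integrable := X1.
have intY : PY.-integrable setT (fun x : R => x%:E).
  apply: integrable_pushforward => //; first by apply/measurable_EFinP.
  by have /Lfun1_integrable := Y1.
rewrite EX.
transitivity (\int[PX]_x (x%:E * 'E_P[Y]))%E.
  apply: eq_integral => x _; rewrite /fubini_F /f /=.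
  by under eq_integral do rewrite EFinM; rewrite integralZl // EY.
rewrite -(fineK (expectation_fin_num Y1)) integralZr //.
Qed.

(** * Calculus of first and second moment matrices *)

Lemma outer_mxE (R : pzSemiRingType) m q (u : 'cV[R]_m) (v : 'cV[R]_q) i j :
  (u *m v^T) i j = u i 0 * v j 0.
Proof. by rewrite mxE big_ord1 mxE. Qed.

Section MatrixMoments.
Context (R : realType) (d : measure_display) (T : measurableType d).
Variable P : probability T R.

Definition L1mx m q (Z : T -> 'M[R]_(m, q)) :=
  forall i j, (fun w => Z w i j) \in Lfun P 1.

Definition L2mx m q (Z : T -> 'M[R]_(m, q)) :=
  forall i j, (fun w => Z w i j) \in Lfun P 2.

Let Pfin : P setT \is a fin_num := fin_num_measure P _ measurableT.

Lemma L2mx_L1mx m q (Z : T -> 'M[R]_(m, q)) : L2mx Z -> L1mx Z.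
Proof. by move=> Z2 i j; exact: Lfun_subset12 Pfin _ (Z2 i j). Qed.

(** Stated for scalar families so that one induction gives every entry of a
    matrix product. *)
Lemma Lfun_lin_comb (p : \bar R) (I : Type) (r : seq I) (c : I -> R)
    (f : I -> T -> R) : (1 <= p)%E ->
  (forall i, f i \in Lfun P p) ->
  (fun w => \sum_(i <- r) c i * f i w) \in Lfun P p.
Proof.
move=> p1 fp; have [L0 LD] := Lfun_submod_closed P p1.
elim: r => [|x r IH].
  by under eq_fun do rewrite big_nil.
under eq_fun do rewrite big_cons.
exact: (LD (c x) _ _ (fp x) IH).
Qed.

Lemma expectation_lin_comb (I : Type) (r : seq I) (c : I -> R)
    (f : I -> T -> R) : (forall i, f i \in Lfun P 1) ->
  ('E_P[fun w => (\sum_(i <- r) c i * f i w)%R] =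
   (\sum_(i <- r) c i * fine 'E_P[f i])%:E)%E.
Proof.
move=> f1; elim: r => [|x r IH].
  by under eq_fun do rewrite big_nil; rewrite big_nil; exact: expectation_cst.
under eq_fun do rewrite big_cons.
rewrite big_cons EFinD -IH EFinM fineK ?expectation_fin_num //.
rewrite -expectationZl //.
rewrite -expectationD ?Lfun_lin_comb ?Lfun_scale //.
by congr expectation; apply/funext => w /=; rewrite mulrC.
Qed.

Lemma L2mx_cst m q (C : 'M[R]_(m, q)) : L2mx (fun=> C).
Proof. by move=> i j; exact: (Lfun_cst P (C i j) 2). Qed.

Lemma L2mxD m q (Z Z' : T -> 'M[R]_(m, q)) :
  L2mx Z -> L2mx Z' -> L2mx (fun w => Z w + Z' w).
Proof.
move=> Z2 Z2' i j; under eq_fun do rewrite mxE.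
have [_ LD] := Lfun_submod_closed P (lee1n 2).
by have := LD 1 _ _ (Z2 i j) (Z2' i j); rewrite scale1r.
Qed.

Lemma L2mxMl m q r (A : 'M[R]_(r, m)) (Z : T -> 'M[R]_(m, q)) :
  L2mx Z -> L2mx (fun w => A *m Z w).
Proof.
move=> Z2 i j; under eq_fun do rewrite mxE.
by apply: Lfun_lin_comb (lee1n 2) _ => k; exact: Z2.
Qed.

Lemma L2mxN m q (Z : T -> 'M[R]_(m, q)) :
  L2mx Z -> L2mx (fun w => - Z w).
Proof.
move=> Z2; have := L2mxMl (- 1%:M) Z2.
by under eq_fun do rewrite mulNmx mul1mx.
Qed.

Lemma L2mxB m q (Z Z' : T -> 'M[R]_(m, q)) :
  L2mx Z -> L2mx Z' -> L2mx (fun w => Z w - Z' w).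
Proof. by move=> Z2 Z2'; apply: L2mxD => //; exact: L2mxN. Qed.

Lemma L2mx_sum m q (I : Type) (r : seq I) (Q : pred I)
    (Z : I -> T -> 'M[R]_(m, q)) :
  (forall i, Q i -> L2mx (Z i)) -> L2mx (fun w => \sum_(i <- r | Q i) Z i w).
Proof.
move=> Z2; elim: r => [|x r IH].
  by under eq_fun do rewrite big_nil; exact: L2mx_cst.
under eq_fun do rewrite big_cons.
by case: (boolP (Q x)) => // Qx; apply: L2mxD => //; exact: Z2.
Qed.

Lemma L1mx_outer m q (X : T -> 'cV[R]_m) (Y : T -> 'cV[R]_q) :
  L2mx X -> L2mx Y -> L1mx (fun w => X w *m (Y w)^T).
Proof.
move=> X2 Y2 i j; under eq_fun do rewrite outer_mxE.
exact: Lfun2_mul_Lfun1 (X2 i 0) (Y2 j 0).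
Qed.

Lemma exp_mxE m q (Z : T -> 'M[R]_(m, q)) i j : L1mx Z ->
  ('E_P[fun w => Z w i j] = (exp_mx P Z i j)%:E)%E.
Proof. by move=> Z1; rewrite mxE fineK // expectation_fin_num. Qed.

Lemma exp_mx_cst m q (C : 'M[R]_(m, q)) : exp_mx P (fun=> C) = C.
Proof. by apply/matrixP => i j; rewrite mxE (expectation_cst P (C i j)). Qed.

Lemma exp_mxD m q (Z Z' : T -> 'M[R]_(m, q)) : L1mx Z -> L1mx Z' ->
  exp_mx P (fun w => Z w + Z' w) = exp_mx P Z + exp_mx P Z'.
Proof.
move=> Z1 Z1'; apply/matrixP => i j; rewrite !mxE.
under eq_fun do rewrite mxE.
have := expectationD (Z1 i j) (Z1' i j) => /= E.
by rewrite -fineD ?expectation_fin_num // -E.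
Qed.

Lemma exp_mxMl m q r (A : 'M[R]_(r, m)) (Z : T -> 'M[R]_(m, q)) :
  L1mx Z -> exp_mx P (fun w => A *m Z w) = A *m exp_mx P Z.
Proof.
move=> Z1; apply/matrixP => i j; rewrite !mxE.
under eq_fun do rewrite mxE.
by rewrite expectation_lin_comb //=; apply: eq_bigr => k _; rewrite mxE.
Qed.

Lemma exp_mxB m q (Z Z' : T -> 'M[R]_(m, q)) : L1mx Z -> L1mx Z' ->
  exp_mx P (fun w => Z w - Z' w) = exp_mx P Z - exp_mx P Z'.
Proof.
move=> Z1 Z1'; apply/matrixP => i j; rewrite !mxE.
under eq_fun do rewrite !mxE.
have := expectationB (Z1 i j) (Z1' i j) => /= E.
by rewrite -fineB ?expectation_fin_num // -E.
Qed.

Lemma exp_mx_sum m q (I : Type) (r : seq I) (Q : pred I)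
    (Z : I -> T -> 'M[R]_(m, q)) : (forall i, Q i -> L2mx (Z i)) ->
  exp_mx P (fun w => \sum_(i <- r | Q i) Z i w) =
  \sum_(i <- r | Q i) exp_mx P (Z i).
Proof.
move=> Z2; elim: r => [|x r IH].
  by under eq_fun do rewrite big_nil; rewrite big_nil exp_mx_cst.
under eq_fun do rewrite big_cons; rewrite big_cons.
case: (boolP (Q x)) => // Qx; rewrite exp_mxD ?IH //.
  by apply: L2mx_L1mx; exact: Z2.
by apply: L2mx_L1mx; exact: L2mx_sum.
Qed.

Lemma exp_mx_tr m q (Z : T -> 'M[R]_(m, q)) :
  exp_mx P (fun w => (Z w)^T) = (exp_mx P Z)^T.
Proof. by apply/matrixP => i j; rewrite !mxE; under eq_fun do rewrite mxE. Qed.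

(** The matrix E[X Y^T], which is the covariance matrix for centered vectors.
    It is bilinear over matrices acting on the left of X and Y, and plays the
    role of an inner product. *)
Definition moment_mx m q (X : T -> 'cV[R]_m) (Y : T -> 'cV[R]_q) :
    'M[R]_(m, q) :=
  exp_mx P (fun w => X w *m (Y w)^T).

Lemma moment_mx_tr m q (X : T -> 'cV[R]_m) (Y : T -> 'cV[R]_q) :
  moment_mx Y X = (moment_mx X Y)^T.
Proof.
by rewrite -exp_mx_tr; congr exp_mx; apply/funext => w; rewrite trmx_mul trmxK.
Qed.

Lemma moment_mxDl m q (X X' : T -> 'cV[R]_m) (Y : T -> 'cV[R]_q) :
  L2mx X -> L2mx X' -> L2mx Y ->
  moment_mx (fun w => X w + X' w) Y = moment_mx X Y + moment_mx X' Y.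
Proof.
move=> X2 X2' Y2; rewrite -exp_mxD; [|exact: L1mx_outer..].
by congr exp_mx; apply/funext => w; rewrite mulmxDl.
Qed.

Lemma moment_mxMl m q r (A : 'M[R]_(r, m)) (X : T -> 'cV[R]_m)
    (Y : T -> 'cV[R]_q) : L2mx X -> L2mx Y ->
  moment_mx (fun w => A *m X w) Y = A *m moment_mx X Y.
Proof.
move=> X2 Y2; rewrite -exp_mxMl; last exact: L1mx_outer.
by congr exp_mx; apply/funext => w; rewrite mulmxA.
Qed.

Lemma moment_mxBl m q (X X' : T -> 'cV[R]_m) (Y : T -> 'cV[R]_q) :
  L2mx X -> L2mx X' -> L2mx Y ->
  moment_mx (fun w => X w - X' w) Y = moment_mx X Y - moment_mx X' Y.
Proof.
move=> X2 X2' Y2; have X2N := L2mxN X2'.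
rewrite moment_mxDl //; congr (_ + _).
under [fun w => - X' w]eq_fun do rewrite -[X' _]mul1mx -mulNmx.
by rewrite moment_mxMl // mulNmx mul1mx.
Qed.

Lemma moment_mxDr m q (X : T -> 'cV[R]_m) (Y Y' : T -> 'cV[R]_q) :
  L2mx X -> L2mx Y -> L2mx Y' ->
  moment_mx X (fun w => Y w + Y' w) = moment_mx X Y + moment_mx X Y'.
Proof.
move=> X2 Y2 Y2'.
by rewrite moment_mx_tr moment_mxDl // linearD /= -!moment_mx_tr.
Qed.

Lemma moment_mxBr m q (X : T -> 'cV[R]_m) (Y Y' : T -> 'cV[R]_q) :
  L2mx X -> L2mx Y -> L2mx Y' ->
  moment_mx X (fun w => Y w - Y' w) = moment_mx X Y - moment_mx X Y'.
Proof.
move=> X2 Y2 Y2'.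
by rewrite moment_mx_tr moment_mxBl // linearB /= -!moment_mx_tr.
Qed.

Lemma moment_mxMr m q r (A : 'M[R]_(r, q)) (X : T -> 'cV[R]_m)
    (Y : T -> 'cV[R]_q) : L2mx X -> L2mx Y ->
  moment_mx X (fun w => A *m Y w) = moment_mx X Y *m A^T.
Proof.
by move=> X2 Y2; rewrite moment_mx_tr moment_mxMl // trmx_mul -moment_mx_tr.
Qed.

Lemma moment_mx_cstl m q (c : 'cV[R]_m) (Y : T -> 'cV[R]_q) : L1mx Y ->
  moment_mx (fun=> c) Y = c *m (exp_mx P Y)^T.
Proof.
move=> Y1; rewrite /moment_mx exp_mxMl ?exp_mx_tr // => i j.
by under eq_fun do rewrite mxE.
Qed.

Lemma moment_mx_suml m q (I : Type) (r : seq I) (Q : pred I)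
    (X : I -> T -> 'cV[R]_m) (Y : T -> 'cV[R]_q) :
  (forall i, Q i -> L2mx (X i)) -> L2mx Y ->
  moment_mx (fun w => \sum_(i <- r | Q i) X i w) Y =
  \sum_(i <- r | Q i) moment_mx (X i) Y.
Proof.
move=> X2 Y2; elim: r => [|x r IH].
  under eq_fun do rewrite big_nil; rewrite big_nil.
  by rewrite moment_mx_cstl ?mul0mx //; exact: L2mx_L1mx.
under eq_fun do rewrite big_cons; rewrite big_cons.
case: (boolP (Q x)) => // Qx; rewrite moment_mxDl ?IH //; first exact: X2.
exact: L2mx_sum.
Qed.

Lemma moment_mx_sumr m q (I : Type) (r : seq I) (Q : pred I)
    (X : T -> 'cV[R]_m) (Y : I -> T -> 'cV[R]_q) :
  L2mx X -> (forall i, Q i -> L2mx (Y i)) ->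
  moment_mx X (fun w => \sum_(i <- r | Q i) Y i w) =
  \sum_(i <- r | Q i) moment_mx X (Y i).
Proof.
move=> X2 Y2; rewrite moment_mx_tr moment_mx_suml // raddf_sum /=.
by apply: eq_bigr => i _; rewrite -moment_mx_tr.
Qed.

(** The quadratic form at x is the second moment of the scalar x^T X. *)
Lemma moment_mx_nnd m (X : T -> 'cV[R]_m) : L2mx X -> nnd (moment_mx X X).
Proof.
move=> X2; split; first by rewrite -moment_mx_tr.
move=> x; have x2 := L2mxMl x^T X2.
have -> : x^T *m moment_mx X X *m x =
    moment_mx (fun w => x^T *m X w) (fun w => x^T *m X w).
  by rewrite moment_mxMr // moment_mxMl // trmxK.
rewrite /moment_mx mxE fine_ge0 //.
apply: expectation_ge0 => w.
by rewrite outer_mxE -expr2 sqr_ge0.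
Qed.

Lemma delta_mulmx_delta m q (A : 'M[R]_(m, q)) i j :
  (delta_mx 0 i *m A *m (delta_mx 0 j)^T) (0 : 'I_1) (0 : 'I_1) = A i j.
Proof. by rewrite -rowE trmx_delta -colE !mxE. Qed.

(** Expand the nonnegative second moment of X_i - c Y_j, with c the coefficient
    of the L^2 projection of X_i on Y_j. *)
Lemma moment_mx_cauchy_schwarz m q (X : T -> 'cV[R]_m) (Y : T -> 'cV[R]_q) i j :
  L2mx X -> L2mx Y -> 0 < moment_mx Y Y j j ->
  moment_mx X Y i j ^+ 2 <= moment_mx X X i i * moment_mx Y Y j j.
Proof.
move=> X2 Y2 y0.
pose c := moment_mx X Y i j / moment_mx Y Y j j.
pose U w : 'cV[R]_1 := delta_mx 0 i *m X w.
pose V w : 'cV[R]_1 := (c *: delta_mx 0 j) *m Y w.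
have U2 : L2mx U by exact: L2mxMl.
have V2 : L2mx V by exact: L2mxMl.
have [_ /(_ 1%:M)] := moment_mx_nnd (L2mxB U2 V2).
rewrite trmx1 mul1mx mulmx1.
have -> : moment_mx (fun w => U w - V w) (fun w => U w - V w) 0 0 =
   moment_mx X X i i - c * moment_mx X Y i j
   - (c * moment_mx X Y i j - c * c * moment_mx Y Y j j).
  rewrite moment_mxBl ?(moment_mxBr U2) ?(moment_mxBr V2) //; last exact: L2mxB.
  rewrite /U /V !moment_mxMl ?moment_mxMr //; try exact: L2mxMl.
  have subE (A B : 'M[R]_1) : (A - B) 0 0 = A 0 0 - B 0 0 by rewrite !mxE.
  have scaleE k (A : 'M[R]_1) : (k *: A) 0 0 = k * A 0 0 by rewrite mxE.
  have trZ : (c *: delta_mx (0 : 'I_1) j)^T = c *: (delta_mx 0 j)^T.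
    by rewrite linearZ.
  rewrite (moment_mx_tr X Y) trZ -!scalemxAl -!scalemxAr !mulmxA !subE !scaleE.
  rewrite !delta_mulmx_delta [(moment_mx X Y)^T _ _]mxE. ring.
move=> H; rewrite -subr_ge0.
have -> : moment_mx X X i i * moment_mx Y Y j j - moment_mx X Y i j ^+ 2 =
  moment_mx Y Y j j * (moment_mx X X i i - c * moment_mx X Y i j
   - (c * moment_mx X Y i j - c * c * moment_mx Y Y j j)).
  by rewrite /c; field; rewrite gt_eqF.
by rewrite mulr_ge0 // ltW.
Qed.

Lemma has_meanP m (X : T -> 'cV[R]_m) mu : L1mx X ->
  has_mean P X mu <-> exp_mx P X = mu.
Proof.
move=> X1; split => [H|<- i]; last by rewrite exp_mxE.
by apply/matrixP => i j; rewrite ord1 mxE H.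
Qed.

Lemma has_covP m (X : T -> 'cV[R]_m) C : L2mx X ->
  moment_mx X X - exp_mx P X *m (exp_mx P X)^T = C -> has_cov P X C.
Proof.
move=> X2 <- i j; have X1 := L2mx_L1mx X2.
have XX1 := Lfun2_mul_Lfun1 (X2 i 0) (X2 j 0).
rewrite covarianceE // (exp_mxE i 0 X1) (exp_mxE j 0 X1) -EFinM.
have subE (A B : 'M[R]_m) : (A - B) i j = A i j - B i j by rewrite !mxE.
rewrite subE outer_mxE EFinB.
congr (_ - _)%E; rewrite -exp_mxE; last exact: L1mx_outer.
by congr expectation; apply/funext => w; rewrite outer_mxE.
Qed.

End MatrixMoments.

(** * Second moments of Brownian motion *)

Section Brownian.
Context (R : realType) (d : measure_display) (T : measurableType d).
Variable P : probability T R.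

Lemma sqr_integrable_Lfun2 (X : T -> R) : measurable_fun [set: T] X ->
  (\int[P]_w (X w ^+ 2)%:E < +oo)%E -> X \in Lfun P 2.
Proof.
move=> mX fin; rewrite inE; apply/andP; split; first by rewrite inE.
rewrite inE /= /finite_norm unlock /Lnorm; apply: poweR_lty.
apply: le_lt_trans fin; rewrite le_eqVlt; apply/orP; left; apply/eqP.
by apply: eq_integral => w _ /=; rewrite powR_mulrn // real_normK ?num_real.
Qed.

Section OneDimensional.
Variables (a b : R) (W : R -> T -> R).
Hypothesis BW : brownian_on P a b W.

(** W t is a linear combination of values of the process, with one term. *)
Lemma brownian_measurable t : t \in `[a, b] -> measurable_fun [set: T] (W t).
Proof.
move=> tab; have [gW _ _ _] := BW.
have [mW _] := gW 1%N (fun=> t) (fun=> 1) (fun=> tab).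
by move: mW; under eq_fun do rewrite big_ord1 mul1r.
Qed.

Lemma brownian_expM s t : s \in `[a, b] -> t \in `[a, b] ->
  ('E_P[W s \* W t] = (Num.min s t)%:E)%E.
Proof.
move=> sab tab; have [_ _ EW CW] := BW.
rewrite -CW // covariance.unlock !EW //=; congr expectation.
by apply/funext => w; rewrite !fctE /= !subr0.
Qed.

(** The covariance axiom at (t, t) is an identity of extended reals, so it
    contains the finiteness of E[W(t)^2]. *)
Lemma brownian_Lfun2 t : t \in `[a, b] -> W t \in Lfun P 2.
Proof.
move=> tab; apply: sqr_integrable_Lfun2; first exact: brownian_measurable.
have := brownian_expM tab tab; rewrite minxx expectation.unlock => E.
apply: (@le_lt_trans _ _ t%:E); last exact: ltry.
by rewrite -E le_eqVlt; apply/orP; left; apply/eqP; apply: eq_integral.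
Qed.

Lemma process_sigma_preimage t A : t \in `[a, b] -> measurable A ->
  process_sigma a b W (W t @^-1` A).
Proof.
move=> tab mA; apply: sub_sigma_algebra; exists t => //.
by exists A => //; rewrite setTI.
Qed.
End OneDimensional.

Section TwoDimensional.
Variables (a b : R) (eps : R -> T -> 'cV[R]_2).
Hypothesis Beps : brownian2_on P a b eps.

Let ord2E (i : 'I_2) : i = 0 \/ i = 1.
Proof. by case: i => [[|[|//]] ?]; [left|right]; apply/val_inj. Qed.

Lemma brownian2_L2mx t : t \in `[a, b] -> L2mx P (eps t).
Proof.
move=> tab i j; rewrite (ord1 j); have [B0 B1 _] := Beps.
case: (ord2E i) => ->; first exact: (brownian_Lfun2 B0 tab).
exact: (brownian_Lfun2 B1 tab).
Qed.

Lemma brownian2_mean t : t \in `[a, b] -> exp_mx P (eps t) = 0.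
Proof.
move=> tab; have [[_ _ E0 _] [_ _ E1 _] _] := Beps.
apply/matrixP => i j; rewrite !mxE (ord1 j).
by case: (ord2E i) => ->; rewrite ?(E0 t tab) ?(E1 t tab).
Qed.

(** The off-diagonal entries vanish because the two coordinates are independent
    and centered. *)
Lemma brownian2_moment s t : s \in `[a, b] -> t \in `[a, b] ->
  moment_mx P (eps s) (eps t) = (Num.min s t)%:M.
Proof.
move=> sab tab; have [B0 B1 I01] := Beps.
have [_ _ E0 _] := B0; have [_ _ E1 _] := B1.
have cross u v : u \in `[a, b] -> v \in `[a, b] ->
    ('E_P[(fun w => eps u w 0 0)%R \* (fun w => eps v w 1 0)%R] = 0)%E.
  move=> uab vab; rewrite expectation_indepM.
  - by rewrite (E0 u uab) mul0e.
  - exact: (brownian_Lfun2 B0 uab).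
  - exact: (brownian_Lfun2 B1 vab).
  - move=> A B mA mB; apply: I01.
      exact: (@process_sigma_preimage _ _ (fun t w => eps t w 0 0)).
    exact: (@process_sigma_preimage _ _ (fun t w => eps t w 1 0)).
apply/matrixP => i j; rewrite /moment_mx !mxE.
have -> : (fun w => (eps s w *m (eps t w)^T) i j) =
    (fun w => eps s w i 0) \* (fun w => eps t w j 0).
  by apply/funext => w; rewrite outer_mxE.
case: (ord2E i) => ->; case: (ord2E j) => -> /=.
- by rewrite (brownian_expM B0 sab tab).
- by rewrite cross.
- rewrite [X in expectation _ X](_ : _ =
      (fun w => eps t w 0 0) \* (fun w => eps s w 1 0)) ?cross //.
  by apply/funext => w /=; rewrite mulrC.
- by rewrite (brownian_expM B1 sab tab).
Qed.
End TwoDimensional.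
End Brownian.

(** * The correlated noise *)

Lemma Sigma_mx_sym (R : realType) (s1 s2 rho : R) :
  (Sigma_mx s1 s2 rho)^T = Sigma_mx s1 s2 rho.
Proof. by apply/matrixP => i j; rewrite !mxE eq_sym; case: eqVneq => // ->. Qed.

Lemma Sigma_mx_unit (R : realType) (s1 s2 rho : R) :
  0 < s1 -> 0 < s2 -> -1 < rho < 1 -> Sigma_mx s1 s2 rho \in unitmx.
Proof.
move=> s10 s20 /andP[r1 r2]; rewrite unitmxE unitfE (expand_det_row _ 0).
rewrite !big_ord_recl big_ord0 /cofactor !det_mx11 !mxE /=.
rewrite [X in X != 0](_ : _ =
    (s1 * s2) ^+ 2 * ((1 - rho) * (1 + rho))); last first.
  by rewrite /bump /= addn0 expr0 expr1; ring.
apply: lt0r_neq0; apply: mulr_gt0; first by apply: exprn_gt0; exact: mulr_gt0.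
by apply: mulr_gt0; lra.
Qed.

Lemma Sigma_mx_diag_gt0 (R : realType) (s1 s2 rho : R) i :
  0 < s1 -> 0 < s2 -> 0 < Sigma_mx s1 s2 rho i i.
Proof.
by move=> s10 s20; rewrite mxE eqxx; case: ifP => _; exact: exprn_gt0.
Qed.

Lemma bilinear_form_sym (R : comPzRingType) m q (A : 'M[R]_(m, q))
    (K : 'M[R]_q) :
  K^T = K -> (A *m K *m A^T)^T = A *m K *m A^T.
Proof. by move=> Ks; rewrite !trmx_mul trmxK Ks mulmxA. Qed.

Lemma int_mx_sym (R : realType) m (a b : R) (G : R -> 'M[R]_m) :
  (forall s, (G s)^T = G s) -> (int_mx a b G)^T = int_mx a b G.
Proof.
move=> Gs; apply/matrixP => i j; rewrite !mxE.
by apply: eq_Rintegral => s _; rewrite -[in LHS]Gs mxE.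
Qed.

Section Noise.
Context (R : realType) (d : measure_display) (T : measurableType d).
Variables (P : probability T R) (a b : R) (Sigma S : 'M[R]_2).
Variable eps : R -> T -> 'cV[R]_2.
Hypothesis Beps : brownian2_on P a b eps.
Hypothesis SS : is_sym_sqrt S Sigma.

Definition noise t w := S *m eps t w.

Lemma noise_L2mx t : t \in `[a, b] -> L2mx P (noise t).
Proof. by move=> tab; apply: L2mxMl; exact: (brownian2_L2mx Beps). Qed.

Lemma noise_mean t : t \in `[a, b] -> exp_mx P (noise t) = 0.
Proof.
move=> tab; rewrite exp_mxMl ?(brownian2_mean Beps) ?mulmx0 //.
exact/L2mx_L1mx/(brownian2_L2mx Beps).
Qed.

(** E[S eps(s) eps(t)^T S^T] = S (min(s, t) I) S, and S S = Sigma. *)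
Lemma noise_moment s t : s \in `[a, b] -> t \in `[a, b] ->
  moment_mx P (noise s) (noise t) = Num.min s t *: Sigma.
Proof.
move=> sab tab; have [[Ssym _] <-] := SS.
have es2 := brownian2_L2mx Beps sab; have et2 := brownian2_L2mx Beps tab.
rewrite moment_mxMl //; last exact: noise_L2mx.
rewrite moment_mxMr // (brownian2_moment Beps) // Ssym mul_scalar_mx.
by rewrite -scalemxAr.
Qed.

End Noise.

(** * The stochastic integral and the noise *)

Section StochasticIntegral.
Context (R : realType) (d : measure_display) (T : measurableType d).
Variables (P : probability T R) (p : nat) (a b : R).
Variables (F dF : R -> 'M[R]_(p, 2)) (Sigma S : 'M[R]_2).
Variables (eps : R -> T -> 'cV[R]_2) (theta : 'cV[R]_p) (J : T -> 'cV[R]_p).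
Hypothesis Beps : brownian2_on P a b eps.
Let Y := obs F S eps theta.
Let Z := noise S eps.
Let riemann_sum n s w : 'cV[R]_p := \sum_(2 <= i < n.+1)
  dF (s i.-1) *m invmx Sigma *m (Y (s i) w - Y (s i.-1) w).

Lemma obs_L2mx t : t \in `[a, b] -> L2mx P (Y t).
Proof.
by move=> tab; apply: L2mxD; [exact: L2mx_cst | exact: (noise_L2mx _ Beps)].
Qed.

Lemma riemann_sum_L2mx n s : is_subdivision a b n s -> L2mx P (riemann_sum n s).
Proof.
move=> sub; rewrite /riemann_sum.
under eq_fun do rewrite big_nat.
apply: L2mx_sum => i iN; apply: L2mxMl; apply: L2mxB;
  apply: obs_L2mx; apply: (subdivision_sub sub); lia.
Qed.

Hypothesis HJ : is_stoch_int P a b (fun s => dF s *m invmx Sigma) Y J.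

Lemma stoch_int_remainder_L2mx n s : is_subdivision a b n s ->
  (forall k,
     ('E_P[fun w => (((J w - riemann_sum n s w) k 0) ^+ 2)%R] < +oo)%E) ->
  L2mx P (fun w => J w - riemann_sum n s w).
Proof.
move=> sub fin i j; rewrite (ord1 j); have [mJ _] := HJ.
apply: sqr_integrable_Lfun2; last by have := fin i; rewrite unlock.
under eq_fun do rewrite !mxE.
apply: measurable_funB; first exact: mJ.
exact: Lfun2_measurable (riemann_sum_L2mx sub i 0).
Qed.

Hypothesis ab : a < b.

(** J is within finite L^2 distance of some Riemann sum, which is square
    integrable. *)
Lemma stoch_int_L2mx : L2mx P J.
Proof.
have [_ /(_ 1 ltr01)[dlt dlt0 H]] := HJ.
have [n [s [sub mesh]]] := fine_subdivision ab dlt0.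
have J2 : L2mx P (fun w => J w - riemann_sum n s w).
  apply: stoch_int_remainder_L2mx => // k.
  by apply: lt_trans (H n s sub mesh k) _; exact: ltry.
have := L2mxD J2 (riemann_sum_L2mx sub).
by under eq_fun do rewrite subrK.
Qed.

Hypothesis SS : is_sym_sqrt S Sigma.

Lemma obs_noise_moment s t : s \in `[a, b] -> t \in `[a, b] ->
  moment_mx P (Y s) (Z t) = Num.min s t *: Sigma.
Proof.
move=> sab tab.
have Zs2 := noise_L2mx S Beps sab; have Zt2 := noise_L2mx S Beps tab.
rewrite moment_mxDl //; last exact: L2mx_cst.
rewrite moment_mx_cstl; last exact: L2mx_L1mx.
by rewrite (noise_mean _ Beps) // trmx0 mulmx0 add0r (noise_moment Beps SS).
Qed.

Hypothesis Sigma_unit : Sigma \in unitmx.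

(** The weight Sigma^-1 of the integrand cancels the covariance Sigma of the
    noise. *)
Lemma riemann_sum_noise_moment n s v : is_subdivision a b n s ->
  v \in `[a, b] ->
  moment_mx P (riemann_sum n s) (Z v) = \sum_(2 <= i < n.+1)
    (Num.min (s i) v - Num.min (s i.-1) v) *: dF (s i.-1).
Proof.
move=> sub vab; have Zv2 := noise_L2mx S Beps vab.
rewrite /riemann_sum; under eq_fun do rewrite big_nat.
have Y2 i : (1 <= i <= n)%N -> L2mx P (Y (s i)).
  by move=> iN; apply: obs_L2mx; exact: (subdivision_sub sub).
rewrite moment_mx_suml //; last first.
  by move=> i iN; apply: L2mxMl; apply: L2mxB; apply: Y2; lia.
rewrite [RHS]big_nat; apply: eq_bigr => i iN.
have [Yi Yi'] : L2mx P (Y (s i)) /\ L2mx P (Y (s i.-1)).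
  by split; apply: Y2; lia.
rewrite moment_mxMl //; last exact: L2mxB.
rewrite moment_mxBl // !obs_noise_moment //;
  try by apply: (subdivision_sub sub); lia.
by rewrite -scalerBl -scalemxAr -mulmxA mulVmx // mulmx1.
Qed.

Hypothesis a0 : 0 < a.
Hypothesis FC1 : C1_on a b F dF.
Hypothesis Sigma_diag : forall l, 0 < Sigma l l.

(** J is the sum of a Riemann sum, whose moment with Z(v) is close to
    F(v) - F(a), and of a remainder that is small in L^2, whose moment with Z(v)
    is small by the Cauchy-Schwarz inequality. *)
Lemma stoch_int_noise_moment v : v \in `[a, b] ->
  moment_mx P J (Z v) = F v - F a.
Proof.
move=> vab; apply/matrixP => k l; apply/eqP; rewrite -subr_eq0 -normr_le0.
apply/ler_addgt0Pl => e e0; rewrite addr0.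
have Zv2 := noise_L2mx S Beps vab.
have v0 : 0 < v.
  by move: vab; rewrite in_itv /= => /andP[av _]; exact: lt_le_trans av.
have Zll : moment_mx P (Z v) (Z v) l l = v * Sigma l l.
  by rewrite (noise_moment Beps SS) // minxx mxE.
have K0 : 0 < v * Sigma l l by rewrite mulr_gt0.
have [df_lim df_cont] := FC1 k l.
have e20 : 0 < e / 2 by lra.
have [dlt1 dlt10 riemann] := riemann_sum_stopped df_lim df_cont vab e20.
(* Chosen so that Cauchy-Schwarz bounds the moment of the remainder by e / 2. *)
have e10 : 0 < (e / 2) ^+ 2 / (v * Sigma l l) by rewrite divr_gt0 // exprn_gt0.
have [_ /(_ _ e10)[dlt2 dlt20 approx]] := HJ.
have dlt0 : 0 < Num.min dlt1 dlt2 by rewrite lt_min dlt10.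
have [n [s [sub mesh]]] := fine_subdivision ab dlt0.
have mesh1 i : (2 <= i <= n)%N -> s i - s i.-1 < dlt1.
  by move=> /mesh; rewrite lt_min => /andP[].
have mesh2 i : (2 <= i <= n)%N -> s i - s i.-1 < dlt2.
  by move=> /mesh; rewrite lt_min => /andP[].
have {}riemann := riemann n s sub mesh1.
have {}approx := approx n s sub mesh2.
have rem2 : L2mx P (fun w => J w - riemann_sum n s w).
  apply: stoch_int_remainder_L2mx => // i.
  by apply: lt_trans (approx i) _; exact: ltry.
have RS2 := riemann_sum_L2mx sub.
set rem := fun w => _ in rem2.
have split_J : moment_mx P J (Z v) = moment_mx P rem (Z v) +
    moment_mx P (riemann_sum n s) (Z v).
  rewrite -moment_mxDl //; congr moment_mx; apply/funext => w.
  by rewrite /rem subrK.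
have entry : moment_mx P (riemann_sum n s) (Z v) k l =
    \sum_(2 <= i < n.+1) dF (s i.-1) k l *
       (Num.min (s i) v - Num.min (s i.-1) v).
  rewrite riemann_sum_noise_moment // summxE.
  by apply: eq_bigr => i _; rewrite mxE mulrC.
have rem_small : `|moment_mx P rem (Z v) k l| <= e / 2.
  rewrite -ler_sqr ?nnegrE ?normr_ge0 ?(ltW e20) // real_normK ?num_real //.
  have := moment_mx_cauchy_schwarz k (j := l) rem2 Zv2; rewrite Zll => /(_ K0).
  move=> /le_trans; apply; rewrite -ler_pdivlMr //.
  rewrite -lee_fin -exp_mxE; last exact: L1mx_outer.
  apply: ltW; apply: le_lt_trans (approx k).
  rewrite le_eqVlt; apply/orP; left; apply/eqP; congr expectation.
  by apply/funext => w; rewrite outer_mxE -expr2.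
have addE (A B : 'M[R]_(p, 2)) : (A + B) k l = A k l + B k l by rewrite mxE.
have FE : (F v - F a) k l = F v k l - F a k l by rewrite !mxE.
rewrite split_J addE entry FE -addrA; apply: le_trans (ler_normD _ _) _.
by rewrite [e]splitr; exact: lerD.
Qed.

End StochasticIntegral.

(** * Weighted increments *)

Section WeightedIncrements.
Context (R : realType) (d : measure_display) (T : measurableType d).
Variables (P : probability T R) (p n : nat) (a b : R).
Variables (F : R -> 'M[R]_(p, 2)) (Sigma S : 'M[R]_2).
Variables (eps : R -> T -> 'cV[R]_2) (t : nat -> R).
Hypothesis SS : is_sym_sqrt S Sigma.
Hypothesis Beps : brownian2_on P a b eps.
Hypothesis sub : is_subdivision a b n t.
Let Z := noise S eps.
Let K := invmx Sigma.

Definition weighted_noise (Phi : nat -> 'M[R]_(p, 2)) w : 'cV[R]_p :=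
  \sum_(2 <= i < n.+1) Phi i *m K *m (Z (t i) w - Z (t i.-1) w).

Definition weighted_drift (Phi : nat -> 'M[R]_(p, 2)) : 'M[R]_p :=
  \sum_(2 <= i < n.+1) Phi i *m K *m (F (t i) - F (t i.-1))^T.

Let t_ab i : (1 <= i <= n)%N -> t i \in `[a, b].
Proof. exact: subdivision_sub. Qed.

Let Z2 i : (1 <= i <= n)%N -> L2mx P (Z (t i)).
Proof. by move=> iN; apply: (noise_L2mx _ Beps); exact: t_ab. Qed.

Let ZB2 i : (2 <= i < n.+1)%N -> L2mx P (fun w => Z (t i) w - Z (t i.-1) w).
Proof. by move=> iN; apply: L2mxB; apply: Z2; lia. Qed.

Lemma noise_increment_mean i : (2 <= i < n.+1)%N ->
  exp_mx P (fun w => Z (t i) w - Z (t i.-1) w) = 0.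
Proof.
move=> iN; rewrite exp_mxB; try by apply: L2mx_L1mx; apply: Z2; lia.
by rewrite !(noise_mean _ Beps) ?subrr //; apply: t_ab; lia.
Qed.

(** Disjoint intervals: the four minima cancel in pairs. *)
Lemma noise_increment_moment i j : (2 <= i < n.+1)%N -> (2 <= j < n.+1)%N ->
  moment_mx P (fun w => Z (t i) w - Z (t i.-1) w)
              (fun w => Z (t j) w - Z (t j.-1) w) =
  (if i == j then t i - t i.-1 else 0) *: Sigma.
Proof.
move=> iN jN.
have Zi := Z2 (i := i) ltac:(lia); have Zi' := Z2 (i := i.-1) ltac:(lia).
have Zj := Z2 (i := j) ltac:(lia); have Zj' := Z2 (i := j.-1) ltac:(lia).
rewrite moment_mxBl ?(moment_mxBr Zi) ?(moment_mxBr Zi') //; last exact: ZB2.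
rewrite !(noise_moment Beps SS); try by apply: t_ab; lia.
rewrite -!scalerBl; congr (_ *: _).
have le_t k l : (1 <= k)%N -> (k <= l <= n)%N -> t k <= t l.
  exact: subdivision_le sub.
have ti := le_t i.-1 i ltac:(lia) ltac:(lia).
have tj := le_t j.-1 j ltac:(lia) ltac:(lia).
case: (ltngtP i j) => [ij|ji|<-].
- have tij := le_t i j.-1 ltac:(lia) ltac:(lia).
  by rewrite !min_l ?subrr //; lra.
- have tji := le_t j i.-1 ltac:(lia) ltac:(lia).
  by rewrite !min_r ?subrr //; lra.
by rewrite !minxx min_r // min_l // subrr subr0.
Qed.

Lemma weighted_noise_L2mx Phi : L2mx P (weighted_noise Phi).
Proof.
rewrite /weighted_noise; under eq_fun do rewrite big_nat.
by apply: L2mx_sum => i iN; apply: L2mxMl; exact: ZB2.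
Qed.

Lemma weighted_noise_mean Phi : exp_mx P (weighted_noise Phi) = 0.
Proof.
rewrite /weighted_noise; under eq_fun do rewrite big_nat.
rewrite exp_mx_sum => [|i iN]; last by apply: L2mxMl; exact: ZB2.
apply: big1 => i iN; rewrite exp_mxMl ?noise_increment_mean ?mulmx0 //.
by apply: L2mx_L1mx; exact: ZB2.
Qed.

(** All increments lie after time a, and min(t_i, a) = a for every i. *)
Lemma weighted_noise_init_moment Phi :
  moment_mx P (weighted_noise Phi) (Z a) = 0.
Proof.
have [n2 t1 _ _] := sub; rewrite -t1.
have Za : L2mx P (Z (t 1%N)) by apply: Z2; lia.
rewrite /weighted_noise; under eq_fun do rewrite big_nat.
rewrite moment_mx_suml //; last by move=> i iN; apply: L2mxMl; exact: ZB2.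
apply: big1 => i iN; rewrite moment_mxMl //; last exact: ZB2.
rewrite moment_mxBl //; try by apply: Z2; lia.
rewrite !(noise_moment Beps SS); try by apply: t_ab; lia.
rewrite !min_r; [by rewrite subrr mulmx0|..];
  by apply: (subdivision_le sub) => //; lia.
Qed.

Hypothesis Sigma_sym : Sigma^T = Sigma.

Let K_sym : K^T = K. Proof. by rewrite /K trmx_inv Sigma_sym. Qed.

(** The moment with a weighted noise is determined by the moments with the
    single increments; used with X the stochastic integral and with X another
    weighted noise. *)
Lemma moment_mx_weighted_noise m (X : T -> 'cV[R]_m) Psi
    (C : nat -> 'M[R]_(m, 2)) : L2mx P X ->
  (forall j, (2 <= j < n.+1)%N ->
     moment_mx P X (fun w => Z (t j) w - Z (t j.-1) w) = C j) ->
  moment_mx P X (weighted_noise Psi) =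
  \sum_(2 <= j < n.+1) C j *m K *m (Psi j)^T.
Proof.
move=> X2 HC; rewrite /weighted_noise; under eq_fun do rewrite big_nat.
rewrite [RHS]big_nat moment_mx_sumr //; last first.
  by move=> j jN; apply: L2mxMl; exact: ZB2.
apply: eq_bigr => j jN; rewrite moment_mxMr ?HC //; last exact: ZB2.
by rewrite trmx_mul K_sym mulmxA.
Qed.

Hypothesis Sigma_unit : Sigma \in unitmx.

Lemma weighted_noise_moment Phi Psi :
  moment_mx P (weighted_noise Phi) (weighted_noise Psi) =
  \sum_(2 <= j < n.+1) (t j - t j.-1) *: (Phi j *m K *m (Psi j)^T).
Proof.
rewrite (@moment_mx_weighted_noise _ _ _ (fun j => (t j - t j.-1) *: Phi j)).
- by apply: eq_bigr => j _; rewrite -!scalemxAl.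
- exact: weighted_noise_L2mx.
move=> j jN; rewrite /weighted_noise; under eq_fun do rewrite big_nat.
rewrite moment_mx_suml; [|by move=> i iN; apply: L2mxMl; exact: ZB2|exact: ZB2].
have term i : (2 <= i < n.+1)%N ->
    moment_mx P (fun w => Phi i *m K *m (Z (t i) w - Z (t i.-1) w))
                (fun w => Z (t j) w - Z (t j.-1) w) =
    (if i == j then t i - t i.-1 else 0) *: Phi i.
  move=> iN; rewrite moment_mxMl; [|exact: ZB2..].
  by rewrite noise_increment_moment // -scalemxAr -mulmxA mulVmx // mulmx1.
rewrite (eq_bigr _ term) -big_nat.
rewrite (bigD1_seq j) ?iota_uniq ?mem_index_iota //= eqxx.
by rewrite big1 ?addr0 // => i /negbTE ->; rewrite scale0r.
Qed.

End WeightedIncrements.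

(** * Optimality and covariance *)

(** Covariances ignore the mean: only the centered part W contributes. *)
Lemma has_cov_shift (R : realType) (d : measure_display) (T : measurableType d)
    (P : probability T R) m (X W : T -> 'cV[R]_m) (mu : 'cV[R]_m) :
  L2mx P W -> exp_mx P W = 0 -> (forall w, X w = mu + W w) ->
  has_cov P X (moment_mx P W W).
Proof.
move=> W2 W0 XE; have -> : X = fun w => mu + W w by apply/funext.
have mu2 : L2mx P (fun=> mu) by exact: L2mx_cst.
have W1 := L2mx_L1mx W2; have X2 := L2mxD mu2 W2.
apply: has_covP => //.
rewrite moment_mxDl // !moment_mxDr // exp_mxD //; last exact: L2mx_L1mx.
rewrite (moment_mx_tr P (fun=> mu) W) !moment_mx_cstl //; last exact: L2mx_L1mx.
rewrite !exp_mx_cst W0 trmx0 mulmx0 trmx0 !addr0 add0r.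
by rewrite addrC addKr.
Qed.

Theorem theorem4p2 (R : realType) (d : measure_display)
    (T : measurableType d) (P : probability T R)
    (p n : nat) (a b : R) (F dF : R -> 'M[R]_(p, 2))
    (sigma1 sigma2 rho : R) (S : 'M[R]_2)
    (eps : R -> T -> 'cV[R]_2) (t : nat -> R) :
  let Sigma := Sigma_mx sigma1 sigma2 rho in
  let M0 := M0_mx a b dF Sigma in
  let M := M_mx a b F dF Sigma in
  let B := B_mx F Sigma n t in
  let Y := obs F S eps in
  let est := theta_n a b F dF Sigma n t in
  let PhiS := Phi_star a b F dF Sigma n t in
  0 < a -> a < b ->
  C1_on a b F dF ->
  lin_indep_on a b F ->
  0 < sigma1 -> 0 < sigma2 -> -1 < rho < 1 ->
  is_sym_sqrt S Sigma ->
  brownian2_on P a b eps ->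
  M \in unitmx ->
  is_subdivision a b n t ->
  B \in unitmx ->
  [/\ unbiased P Y (est PhiS),
      forall (theta : 'cV[R]_p) (J : T -> 'cV[R]_p),
        is_stoch_int P a b (fun s => dF s *m invmx Sigma) (Y theta) J ->
        let y w := fun s => Y theta s w in
        let err Phi w :=
          theta_BLUE a b F dF Sigma (J w) (y w) - est Phi (y w) in
        forall Phi : nat -> 'M[R]_(p, 2), unbiased P Y (est Phi) ->
          loewner_le (exp_mx P (fun w => err PhiS w *m (err PhiS w)^T))
                     (exp_mx P (fun w => err Phi w *m (err Phi w)^T)) &
      forall theta : 'cV[R]_p,
        has_cov P (fun w => est PhiS (fun s => Y theta s w))
          (invmx M *m
             (M0 *m invmx B *m M0 + a^-1 *: (F a *m invmx Sigma *m (F a)^T))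
           *m invmx M)].
Proof.
move=> Sigma M0 M B Y est PhiS a0 ab FC1 _ s10 s20 rho1 SS Beps Munit sub Bunit.
pose K := invmx Sigma; pose A := F a *m K *m (F a)^T.
pose Z := noise S eps.
have Sigma_unit : Sigma \in unitmx by exact: Sigma_mx_unit.
have Sigma_sym : Sigma^T = Sigma by exact: Sigma_mx_sym.
have Sigma_diag l : 0 < Sigma l l by exact: Sigma_mx_diag_gt0.
have K_sym : K^T = K by rewrite /K trmx_inv Sigma_sym.
have M0_sym : M0^T = M0 by apply: int_mx_sym => s; exact: bilinear_form_sym.
have A_sym : A^T = A by exact: bilinear_form_sym.
have ME : M = M0 + a^-1 *: A by [].
have M_sym : M^T = M by rewrite ME linearD linearZ /= M0_sym A_sym.
have aab : a \in `[a, b] by rewrite in_itv /= lexx ltW.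
have dt_neq0 i : (2 <= i < n.+1)%N -> t i - t i.-1 != 0.
  by move=> iN; rewrite subr_eq0 gt_eqF //; have [_ _ _ inc] := sub; apply: inc.
pose N : (nat -> 'M[R]_(p, 2)) -> T -> 'cV[R]_p :=
  weighted_noise n Sigma S eps t.
pose C := weighted_drift n F Sigma t.
have N2 Phi : L2mx P (N Phi) by exact: (weighted_noise_L2mx _ _ Beps sub).
have N0 Phi : exp_mx P (N Phi) = 0 by exact: (weighted_noise_mean _ _ Beps sub).
have NN := weighted_noise_moment SS Beps sub Sigma_sym Sigma_unit.
have Za2 := noise_L2mx S Beps aab; have Za0 := noise_mean S Beps aab.
have incrE Phi theta w : \sum_(2 <= i < n.+1)
      Phi i *m K *m (Y theta (t i) w - Y theta (t i.-1) w) =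
    C Phi *m theta + N Phi w.
  rewrite /C /N /weighted_drift /weighted_noise mulmx_suml -big_split /=.
  apply: eq_bigr => i _; rewrite -(mulmxA _ _ theta) -mulmxDr; congr (_ *m _).
  by rewrite linearB /= mulmxBl /Y /obs /noise opprD addrACA.
pose V Phi w := N Phi w + (a^-1 *: (F a *m K)) *m Z a w.
have HZ2 : L2mx P (fun w => (a^-1 *: (F a *m K)) *m Z a w) by exact: L2mxMl.
have V2 Phi : L2mx P (V Phi) by exact: L2mxD.
have W2 Phi : L2mx P (fun w => invmx M *m V Phi w) by exact: L2mxMl.
have W0 Phi : exp_mx P (fun w => invmx M *m V Phi w) = 0.
  rewrite exp_mxMl; last exact: L2mx_L1mx.
  rewrite exp_mxD; [|exact: L2mx_L1mx..].
  by rewrite N0 exp_mxMl ?Za0 ?mulmx0 ?addr0 ?mulmx0 //; exact: L2mx_L1mx.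
have estE Phi theta w : est Phi (fun s => Y theta s w) =
    invmx M *m (C Phi + a^-1 *: A) *m theta + invmx M *m V Phi w.
  rewrite /est /theta_n -/M incrE /V -[Y theta a w]/((F a)^T *m theta + Z a w).
  have -> : a^-1 *: (F a *m invmx Sigma *m ((F a)^T *m theta + Z a w)) =
      a^-1 *: A *m theta + a^-1 *: (F a *m K) *m Z a w.
    by rewrite mulmxDr scalerDr -!scalemxAl !mulmxA.
  by rewrite addrACA -mulmxDl mulmxDr mulmxA.
have est_mean Phi theta :
    L2mx P (fun w => est Phi (fun s => Y theta s w)) /\
    exp_mx P (fun w => est Phi (fun s => Y theta s w)) =
    invmx M *m (C Phi + a^-1 *: A) *m theta.
  under eq_fun do rewrite estE; split; first exact: (L2mxD (L2mx_cst _ _)).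
  rewrite exp_mxD; last 2 first.
  - exact/L2mx_L1mx/L2mx_cst.
  - exact: L2mx_L1mx.
  by rewrite exp_mx_cst W0 addr0.
(* Taking the basis vectors for theta identifies the matrix of the mean. *)
have unbiasedP Phi : unbiased P Y (est Phi) <-> C Phi = M0.
  split=> [unb|CM0 theta].
    have inv1 : invmx M *m (C Phi + a^-1 *: A) = 1%:M.
      apply/matrixP => i j.
      have [e2 eE] := est_mean Phi (delta_mx j 0).
      have /(has_meanP _ (L2mx_L1mx e2)) := unb (delta_mx j 0).
      rewrite eE => /matrixP/(_ i 0); rewrite -colE !mxE => ->.
      by rewrite andbT.
    have : M *m (invmx M *m (C Phi + a^-1 *: A)) = M by rewrite inv1 mulmx1.
    by rewrite mulKVmx // ME => /addIr.
  have [e2 eE] := est_mean Phi theta.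
  apply/(has_meanP _ (L2mx_L1mx e2)); rewrite eE CM0 -ME mulVmx //.
  exact: mul1mx.
have CPhiS : C PhiS = M0.
  transitivity (M0 *m invmx B *m B); last by rewrite mulmxKV.
  rewrite /C /weighted_drift {2}/B /B_mx mulmx_sumr; apply: eq_bigr => i _.
  by rewrite /PhiS /Phi_star -scalemxAr -!scalemxAl -scalemxAr !mulmxA.
(* The factor 1 / (t_j - t_{j-1}) of Phi* cancels the length of the interval. *)
have NSN Psi : moment_mx P (N PhiS) (N Psi) = M0 *m invmx B *m (C Psi)^T.
  rewrite NN /C /weighted_drift linear_sum mulmx_sumr /=.
  rewrite big_nat [RHS]big_nat; apply: eq_bigr => j jN.
  rewrite !trmx_mul trmxK K_sym /PhiS /Phi_star -scalemxAr -!scalemxAl scalerA.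
  by rewrite mulfV ?dt_neq0 // scale1r !mulmxA.
split.
- exact/unbiasedP.
- move=> theta J HJ y err Phi /unbiasedP CPhi.
  pose Q i := PhiS i - Phi i.
  have CQ : C Q = 0.
    transitivity (C PhiS - C Phi); last by rewrite CPhiS CPhi subrr.
    rewrite /C /weighted_drift -sumrB; apply: eq_bigr => i _.
    by rewrite /Q !mulmxBl.
  have NQ w : N Q w = N PhiS w - N Phi w.
    rewrite /N /weighted_noise -sumrB; apply: eq_bigr => i _.
    by rewrite /Q !mulmxBl.
  have errE Phi' w :
      err Phi' w = invmx M *m (J w - (C Phi' *m theta + N Phi' w)).
    rewrite /err /theta_BLUE /est /theta_n -mulmxBr incrE.
    by rewrite opprD addrACA subrr addr0.
  have J2 : L2mx P J.
    exact: stoch_int_L2mx Beps HJ ab.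
  (* E[J (Z(t_j) - Z(t_{j-1}))^T] = F(t_j) - F(t_{j-1}), so
     E[J N[Q]^T] = C[Q]^T. *)
  have JN : moment_mx P J (N Q) = 0.
    rewrite (@moment_mx_weighted_noise _ _ _ _ _ _ _ _ _ _ _ _ Beps sub
              Sigma_sym _ _ _
              (fun j => F (t j) - F (t j.-1))) //.
      transitivity (C Q)^T; last by rewrite CQ trmx0.
      rewrite /C /weighted_drift linear_sum /=; apply: eq_bigr => j _.
      by rewrite !trmx_mul trmxK K_sym mulmxA.
    move=> j jN; have tj k : (1 <= k <= n)%N -> t k \in `[a, b].
      exact: subdivision_sub.
    rewrite moment_mxBr //; try by apply: (noise_L2mx _ Beps); apply: tj; lia.
    have JZ :=
      stoch_int_noise_moment Beps HJ ab SS Sigma_unit a0 FC1 Sigma_diag.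
    rewrite !JZ;
      try by apply: tj; lia.
    by rewrite opprB addrA subrK.
  have NSQ : moment_mx P (N PhiS) (N Q) = 0 by rewrite NSN CQ trmx0 mulmx0.
  (* E is kept opaque: unfolded, it is a difference that the additivity of
     moments would split. *)
  have [E EP] : exists E, E = err PhiS by exists (err PhiS).
  pose D w := invmx M *m N Q w.
  have D2 : L2mx P D by exact: L2mxMl.
  have drift2 : L2mx P (fun w => C PhiS *m theta + N PhiS w).
    by apply: L2mxD => //; exact: L2mx_cst.
  have EE : E = fun w => invmx M *m (J w - (C PhiS *m theta + N PhiS w)).
    by rewrite EP; apply/funext => w; exact: errE.
  have err2 : L2mx P E.
    rewrite EE.
    by apply: L2mxMl; exact: L2mxB.
  have orth : moment_mx P E D = 0.
    rewrite EE moment_mxMl //; last exact: L2mxB.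
    rewrite moment_mxMr ?moment_mxBl //; last exact: L2mxB.
    rewrite moment_mxDl //; last exact: L2mx_cst.
    rewrite moment_mx_cstl; last exact: L2mx_L1mx.
    by rewrite N0 JN NSQ trmx0 mulmx0 addr0 subrr mul0mx mulmx0.
  have errD w : err Phi w = E w + D w.
    rewrite EE /D errE NQ CPhi CPhiS -mulmxDr; congr (_ *m _).
    by rewrite !opprD !addrA subrK.
  rewrite /loewner_le -/(moment_mx P (err PhiS) (err PhiS)) -EP.
  have -> : exp_mx P (fun w => err Phi w *m (err Phi w)^T) =
      moment_mx P E E + moment_mx P D D.
    under eq_fun do rewrite errD.
    rewrite -/(moment_mx P (fun w => E w + D w) (fun w => E w + D w)).
    rewrite moment_mxDl //; last exact: L2mxD.
    rewrite (moment_mxDr err2) // (moment_mxDr D2) //.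
    by rewrite (moment_mx_tr P E D) orth trmx0 addr0 add0r.
  by rewrite addrAC subrr add0r; exact: moment_mx_nnd.
- move=> theta.
  have := has_cov_shift (W2 PhiS) (W0 PhiS) (estE PhiS theta).
  suff -> : moment_mx P (fun w => invmx M *m V PhiS w)
                        (fun w => invmx M *m V PhiS w)
    = invmx M *m (M0 *m invmx B *m M0 + a^-1 *: A) *m invmx M by [].
  rewrite moment_mxMl ?moment_mxMr // trmx_inv M_sym mulmxA.
  congr (_ *m _ *m _).
  rewrite moment_mxDl ?moment_mxDr // NSN CPhiS M0_sym.
  rewrite !(moment_mxMr (a^-1 *: (F a *m K))) //.
  rewrite !(moment_mxMl (a^-1 *: (F a *m K))) //.
  rewrite (moment_mx_tr P (N PhiS) (Z a)).
  rewrite (weighted_noise_init_moment SS Beps sub).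
  rewrite trmx0 mul0mx !mulmx0 addr0 add0r; congr (_ + _).
  rewrite (noise_moment Beps SS) // minxx.
  rewrite [(a^-1 *: _)^T]linearZ /= trmx_mul K_sym.
  have -> : a^-1 *: (F a *m K) *m (a *: Sigma) = F a.
    by rewrite -scalemxAl -scalemxAr scalerA mulVf ?gt_eqF // scale1r mulmxKV.
  by rewrite -scalemxAr mulmxA.
Qed.
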